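(* Let $\Theta_0,\Theta_1\subset\Lambda$. If there is a pointwise consistent sequence of tests for $H_0: P\in\Theta_0$ versus $H_1: P\in\Theta_1$, then there is a discernible sequence of tests for $H_0$ versus $H_1$.
   Context: $\Omega$ is a topological space with Borel $\sigma$-field $\mathfrak{B}$, and $\Lambda$ is the set of all probability measures on $(\Omega,\mathfrak{B})$. One observes i.i.d. random variables $X_1,X_2,\ldots$ with values in $\Omega$ and distribution $P\in\Lambda$. A test $K_n$ is a measurable function of $(X_1,\ldots,X_n)$ with values in $[0,1]$ (the probability of rejecting the hypothesis). Put $\alpha_P(K_n)=E_P[K_n]$ for $P\in\Theta_0$ and $\beta_P(K_n)=E_P[1-K_n]$ for $P\in\Theta_1$. A sequence of tests $K_n$ is pointwise consistent if $\lim_{n\to\infty}\alpha_P(K_n)=0$ for every $P\in\Theta_0$ and $\lim_{n\to\infty}\beta_Q(K_n)=0$ for every $Q\in\Theta_1$. A sequence of (nonrandomized, i.e. $\{0,1\}$-valued) tests $K_n$ is discernible if $P(K_n=1 \text{ for only finitely many } n)=1$ for all $P\in\Theta_0$ and $P(K_n=0\text{ for only finitely many } n)=1$ for all $P\in\Theta_1$. *)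

(* Defs.v *)
From mathcomp Require Import all_boot all_order all_algebra finmap.
From mathcomp Require Import all_classical all_reals all_analysis.
Import numFieldNormedType.Exports.

Set Implicit Arguments.
Unset Strict Implicit.
Unset Printing Implicit Defensive.

Import Order.TTheory GRing.Theory Num.Theory.

Local Open Scope classical_set_scope.
Local Open Scope ring_scope.

(* [Omega] with its Borel sigma-field. The sigma-field on
   [n.-tuple (borelType Omega)] is the n-fold product of Borel sigma-fields,
   not the Borel sigma-field of the product topology. *)
Definition borelType (Omega : ptopologicalType) :=
  g_sigma_algebraType (@open Omega).

Section observations.
Context {R : realType} {d d' : measure_display}.
Context {T : measurableType d} {S : measurableType d'}.

Definition mutually_independent (mu : probability T R)
    (X : nat -> {mfun T >-> S}) : Prop :=
  forall (J : {fset nat}) (A : nat -> set S),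
    (forall i, measurable (A i)) ->
    mu (\bigcap_(i in [set` J]) X i @^-1` A i) =
      (\prod_(i <- J) mu (X i @^-1` A i))%E.

Definition iid_with_law (mu : probability T R) (X : nat -> {mfun T >-> S})
    (P : probability S R) : Prop :=
  (forall (i : nat) (A : set S), measurable A -> distribution mu (X i) A = P A)
  /\ mutually_independent mu X.

(* Observations are indexed from 0: this is (X 0, ..., X n.-1). *)
Definition sample (X : nat -> {mfun T >-> S}) (n : nat) (w : T) : n.-tuple S :=
  [tuple X i w | i < n].

End observations.

Section tests.
Context {R : realType} {d' : measure_display} {S : measurableType d'}.

Definition is_test (n : nat) (K : n.-tuple S -> R) : Prop :=
  measurable_fun setT K /\ forall x, 0 <= K x <= 1.

Definition is_nonrandomized_test (n : nat) (K : n.-tuple S -> R) : Prop :=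
  is_test K /\ forall x, K x = 0 \/ K x = 1.

End tests.

(* Below, [Pr P] is the probability on the underlying sample space [T] under
   which the observations [X] are i.i.d. with law [P]. *)
Section error_probabilities.
Context {R : realType} {d d' : measure_display}.
Context {T : measurableType d} {S : measurableType d'}.
Variables (X : nat -> {mfun T >-> S}) (Pr : probability S R -> probability T R).

Definition alpha (P : probability S R) (n : nat) (K : n.-tuple S -> R) :
    \bar R :=
  'E_(Pr P)[(fun w => K (sample X n w))%R]%E.

Definition beta (P : probability S R) (n : nat) (K : n.-tuple S -> R) :
    \bar R :=
  'E_(Pr P)[(fun w => 1 - K (sample X n w))%R]%E.

Definition pointwise_consistent (Theta0 Theta1 : set (probability S R))
    (K : forall n, n.-tuple S -> R) : Prop :=
  (forall P, Theta0 P -> alpha P (K n) @[n --> \oo] --> 0%E) /\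
  (forall Q, Theta1 Q -> beta Q (K n) @[n --> \oo] --> 0%E).

Definition discernible (Theta0 Theta1 : set (probability S R))
    (K : forall n, n.-tuple S -> R) : Prop :=
  (forall P, Theta0 P ->
    Pr P [set w | finite_set [set n | K n (sample X n w) = 1]] = 1%E) /\
  (forall P, Theta1 P ->
    Pr P [set w | finite_set [set n | K n (sample X n w) = 0]] = 1%E).

End error_probabilities.

(* Main.v *)
Require Import Defs.
From HB Require Import structures.
From mathcomp Require Import all_boot all_order all_algebra finmap.
From mathcomp Require Import all_classical all_reals all_analysis.
From mathcomp Require Import measurable_realfun ring lra.

(** Let [K] be pointwise consistent, and let [C b] be the set of samples of
    size [b] on which [K b >= 1/2].  By Markov's inequality the nonrandomized
    tests with rejection regions [C b] are still pointwise consistent.  Their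
    errors tend to 0, but perhaps too slowly to be summable; a majority vote
    makes them summable without any knowledge of the rate.  Out of [n]
    observations form [2k] disjoint blocks of length [k], apply [C k] to each
    block, and reject when at least [k] blocks vote for rejection.  An error of
    either kind requires [k] of the [2k] blocks to vote wrongly.

    If a block votes wrongly with probability at most [p], the probability that
    at least [k] among [j] blocks do so is at most [2^j p^k]
    ([probability_at_least_votes]): by induction on [j], either there are
    already [k] wrong votes among the first [j-1] blocks, or there are [k-1] of
    them and the last block, which is independent of the others, is wrong too.
    With [j = 2k] the bound is [(4p)^k], which is at most [2^-k] as soon as
    [p <= 1/8], hence for all large [k] by consistency.  By Borel-Cantelli,
    almost surely only finitely many [k] produce an error.

    The test of sample size [n] uses [k = block_size n], which tends to
    infinity slowly enough for the [2k] blocks to fit into [n] observations.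
    Hence only finitely many [n] produce an error
    ([majority_finitely_often]).

    The independence and the common law of the blocks come from the
    independence of single observations, that is, from the values of measures
    on rectangles, because these form a pi-system generating the product
    sigma-algebra ([tuple_measure_unique]). *)

Import Order.TTheory GRing.Theory Num.Theory.
Local Open Scope classical_set_scope.
Local Open Scope ring_scope.

Set Implicit Arguments.
Unset Strict Implicit.

(** * Measures on tuples are determined by rectangles *)

Section rectangles.
Context {d : measure_display} {S : measurableType d}.

(** The sides form an infinite sequence, so that cutting and gluing rectangles
    of different dimensions needs no arithmetic on ordinals. *)
Definition rectangle (n : nat) (A : nat -> set S) : set (n.-tuple S) :=
  [set x | forall i : 'I_n, A i (tnth x i)].
Arguments rectangle : clear implicits.

Lemma measurable_rectangle (n : nat) (A : nat -> set S) :
  (forall i, measurable (A i)) -> measurable (rectangle n A).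
Proof.
move=> mA.
have -> : rectangle n A =
    \bigcap_(i in [set: 'I_n]) ((@tnth n S)^~ i @^-1` A i).
  by apply/seteqP; split => [x xA i _|x xA i]; exact: xA.
apply: fin_bigcap_measurable => // i _; rewrite -[X in measurable X]setTI.
exact: measurable_tnth.
Qed.

(** The cylinders that generate the product sigma-algebra are the rectangles
    with at most one nontrivial side. *)
Lemma measurable_tupleE (n : nat) :
  @measurable _ (n.-tuple S) =
  <<s [set rectangle n A | A in [set A | forall i, measurable (A i)]] >>.
Proof.
apply/seteqP; split; last first.
  apply: smallest_sub; first exact: sigma_algebra_measurable.
  by move=> _ [A mA <-]; exact: measurable_rectangle.
apply: smallest_sub; first exact: smallest_sigma_algebra.
move=> B; rewrite -bigcup_seq => -[i _ [C mC <-]].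
apply: sub_sigma_algebra; exists (fun j => if j == i :> nat then C else setT).
  by move=> j; case: ifP.
rewrite setTI; apply/seteqP; split => [x /(_ i)|x Cx j] /=.
  by rewrite eqxx.
by case: ifPn => // /eqP/val_inj ->.
Qed.

Lemma tuple_measure_unique (R : realType) (n : nat)
    (m1 m2 : {measure set (n.-tuple S) -> \bar R}) :
    (forall A, (forall i, measurable (A i)) ->
      m1 (rectangle n A) = m2 (rectangle n A)) ->
    (m1 setT < +oo)%E ->
  forall B, measurable B -> m1 B = m2 B.
Proof.
move=> m12 m1oo B; have rectT : rectangle n (fun=> setT) = setT.
  by apply/seteqP; split.
apply: (measure_unique _ (fun=> setT) (measurable_tupleE n)).
- move=> _ _ [A mA <-] [A' mA' <-]; exists (fun i => A i `&` A' i).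
    by move=> i; exact: measurableI.
  apply/seteqP; split => [x h|x [h h'] i]; last by split.
  by split => i; have [] := h i.
- by move=> i; exists (fun=> setT).
- by rewrite bigcup_const.
- by move=> _ [A mA <-]; exact: m12.
- by [].
Qed.

End rectangles.
Arguments rectangle {d S} n A.

(** * Law and independence of disjoint blocks of observations *)

Section sample_law.
Context {R : realType} {d d' : measure_display}.
Context {T : measurableType d} {S : measurableType d'}.

Lemma measurable_sample (X : nat -> {mfun T >-> S}) (n : nat) :
  measurable_fun setT (sample X n).
Proof.
apply/measurable_fun_tnthP => i.
rewrite (_ : _ \o _ = X i) //.
by apply/funext => w; rewrite /= tnth_mktuple.
Qed.

HB.instance Definition _ X n :=
  isMeasurableFun.Build _ _ T (n.-tuple S) (sample X n)
    (@measurable_sample X n).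

(** Both sides are finite measures in [B], so equality on rectangles
    suffices. *)
Lemma tuple_indep_event (mu : probability T R) (n : nat)
    (f : {mfun T >-> n.-tuple S}) (F : set T) :
    measurable F ->
    (forall A, (forall i, measurable (A i)) ->
      mu (f @^-1` rectangle n A `&` F) =
        (mu (f @^-1` rectangle n A) * mu F)%E) ->
  forall B, measurable B -> mu (f @^-1` B `&` F) = (mu (f @^-1` B) * mu F)%E.
Proof.
move=> mF rectF B mB.
pose r := NngNum (fine_ge0 (measure_ge0 mu F)).
have scaleE A : mscale r (distribution mu f) A = (mu (f @^-1` A) * mu F)%E.
  by rewrite muleC /mscale /= fineK // fin_num_measure.
rewrite -scaleE; have mf : measurable_fun setT f by [].
apply: (@tuple_measure_unique _ _ _ _ (pushforward (mrestr mu mF) f)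
  (mscale r (distribution mu f))) => //.
- by move=> A mA; apply: etrans (rectF A mA) (esym (scaleE _)).
- change (mu (setT `&` F) < +oo)%E.
  by rewrite setTI (le_lt_trans (probability_le1 _ _)) ?ltry.
Qed.

Context (mu : probability T R) (X : nat -> {mfun T >-> S})
  (P : probability S R).
Hypothesis iidX : iid_with_law mu X P.

Definition shifted (m i : nat) : {mfun T >-> S} := X (m + i)%N.

(** Mutual independence applied to the indices [m, ..., m + n - 1]. *)
Lemma sample_shifted_rectangle (m n : nat) (A : nat -> set S) :
    (forall i, measurable (A i)) ->
  mu (sample (shifted m) n @^-1` rectangle n A) = (\prod_(i < n) P (A i))%E.
Proof.
move=> mA; have [lawX indX] := iidX.
have := indX [fset i in iota m n]%fset (fun j => A (j - m)%N) (fun=> mA _).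
have -> : \bigcap_(i in [set` [fset i in iota m n]%fset])
    (X i @^-1` A (i - m)%N) = sample (shifted m) n @^-1` rectangle n A.
  apply/seteqP; split => w h.
    move=> i; rewrite /sample tnth_mktuple.
    have /h : [set` [fset i in iota m n]%fset] (m + i)%N.
      by rewrite /= !inE mem_iota leq_addr ltn_add2l ltn_ord.
    by rewrite /= addKn.
  move=> j /=; rewrite !inE mem_iota => /andP[mj jmn].
  have jn : (j - m < n)%N by rewrite ltn_subLR.
  have := h (Ordinal jn).
  by rewrite /sample tnth_mktuple /= /shifted subnKC.
move=> ->.
rewrite (perm_big (iota m n)) /=; last first.
  apply: uniq_perm; [exact: fset_uniq|exact: iota_uniq|].
  by move=> i; rewrite !inE.
rewrite -[m in iota m]addn0 iotaDl big_map -[n in iota 0 n]subn0.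
rewrite -/(index_iota 0 n) big_mkord; apply: eq_bigr => i _.
by rewrite addKn; exact: lawX.
Qed.

Lemma sample_shifted_law (m n : nat) (B : set (n.-tuple S)) :
  measurable B ->
  mu (sample (shifted m) n @^-1` B) = mu (sample X n @^-1` B).
Proof.
apply: (@tuple_measure_unique _ _ _ _
  (distribution mu (sample (shifted m) n)) (distribution mu (sample X n))).
  move=> A mA; transitivity (\prod_(i < n) P (A i))%E.
    exact: sample_shifted_rectangle.
  exact/esym/(sample_shifted_rectangle 0).
by change (mu setT < +oo)%E; rewrite probability_setT ltry.
Qed.

(** Two applications of [tuple_indep_event] replace [B] and [C] by rectangles;
    these glue into one rectangle of dimension [m + n]. *)
Lemma sample_shifted_indep (m n : nat) (B : set (m.-tuple S))
    (C : set (n.-tuple S)) :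
    measurable B -> measurable C ->
  mu (sample X m @^-1` B `&` sample (shifted m) n @^-1` C) =
    (mu (sample X m @^-1` B) * mu (sample (shifted m) n @^-1` C))%E.
Proof.
move=> mB mC; apply: tuple_indep_event => // [|A mA].
  by rewrite -[X in measurable X]setTI; exact: measurable_sample.
rewrite setIC muleC; apply: tuple_indep_event => // [|A' mA'].
  rewrite -[X in measurable X]setTI; apply: measurable_sample => //.
  exact: measurable_rectangle.
pose A'' i := if (i < m)%N then A i else A' (i - m)%N.
have mA'' i : measurable (A'' i) by rewrite /A''; case: ifP.
have -> : sample (shifted m) n @^-1` rectangle n A' `&`
    sample X m @^-1` rectangle m A =
    sample (shifted 0) (m + n) @^-1` rectangle (m + n) A''.
  apply/seteqP; split => w.
    move=> [wA' wA] i; rewrite tnth_mktuple /A''; case: ifPn => im.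
      by have := wA (Ordinal im); rewrite tnth_mktuple.
    rewrite -leqNgt in im.
    have imn : (i - m < n)%N by rewrite ltn_subLR.
    by have := wA' (Ordinal imn); rewrite tnth_mktuple /= /shifted subnKC.
  move=> wA''; split => i; rewrite tnth_mktuple.
    have := wA'' (rshift m i); rewrite tnth_mktuple /A'' /= ltnNge leq_addr /=.
    by rewrite addKn.
  by have := wA'' (lshift n i); rewrite tnth_mktuple /A'' /= ltn_ord.
have rectX : mu (sample X m @^-1` rectangle m A) = (\prod_(i < m) P (A i))%E.
  exact: (sample_shifted_rectangle 0).
rewrite !sample_shifted_rectangle // rectX.
rewrite big_split_ord /= [RHS]muleC; congr (_ * _)%E; apply: eq_bigr => i _.
  by rewrite /A'' /= ltn_ord.
by rewrite /A'' /= ltnNge leq_addr /= addKn.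
Qed.

End sample_law.

(** * Counting how many events of a sequence occur *)

Section at_least.
Context {U : Type}.

Definition at_least (A : nat -> set U) (j k : nat) : set U :=
  [set u | (k <= \sum_(i < j) (u \in A i))%N].

Lemma at_least0 (A : nat -> set U) (j : nat) : at_least A j 0 = setT.
Proof. by apply/seteqP; split. Qed.

Lemma at_least_gt0 (A : nat -> set U) (k : nat) : at_least A 0 k.+1 = set0.
Proof. by apply/seteqP; split => // u; rewrite /at_least /= big_ord0. Qed.

(** The recursion behind the bound on majority errors: [k + 1] occurrences among
    [j + 1] events are already there without the last event, or else the last
    event occurs. *)
Lemma at_leastS (A : nat -> set U) (j k : nat) :
  at_least A j.+1 k.+1 = at_least A j k.+1 `|` (at_least A j k `&` A j).
Proof.
apply/seteqP; split => u; rewrite /at_least /= big_ord_recr /=.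
  case: (boolP (u \in A j)) => [/set_mem uA|_]; last by rewrite addn0; left.
  by rewrite addn1 ltnS; right.
case=> [/leq_trans->//|[uk /mem_set ->]]; first exact: leq_addr.
by rewrite addn1 ltnS.
Qed.

Lemma eq_at_least (A B : nat -> set U) (j k : nat) :
  (forall i, (i < j)%N -> A i = B i) -> at_least A j k = at_least B j k.
Proof.
move=> AB; apply/funext => u; congr (is_true (k <= _)%N).
by apply: eq_bigr => i _; rewrite AB.
Qed.

(** With [j = 2k] and [a = b = k]: if fewer than [k] of the [2k] blocks vote for
    rejection, then at least [k] vote against it.  This makes the two kinds of
    error symmetric. *)
Lemma at_leastC (A : nat -> set U) (j a b : nat) : (a + b <= j.+1)%N ->
  ~` at_least A j a `<=` at_least (fun i => ~` A i) j b.
Proof.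
move=> abj u /negP; rewrite /at_least /= -ltnNge => ua.
have : (\sum_(i < j) (u \in A i) + \sum_(i < j) (u \in ~` A i) = j)%N.
  rewrite -big_split /= -[RHS]card_ord -sum1_card; apply: eq_bigr => i _.
  by rewrite in_setC; case: (u \in A i).
move=> E; rewrite -(leq_add2l a) (leq_trans abj) //.
by rewrite -[in j.+1]E -addSn leq_add2r.
Qed.

End at_least.

Lemma preimage_at_least {U V : Type} (f : U -> V) (A : nat -> set V)
    (j k : nat) :
  f @^-1` at_least A j k = at_least (fun i => f @^-1` A i) j k.
Proof. by []. Qed.

Lemma measurable_at_least d (U : measurableType d) (A : nat -> set U)
    (j k : nat) :
  (forall i, measurable (A i)) -> measurable (at_least A j k).
Proof.
move=> mA; elim: j k => [|j IH] [|k]; rewrite ?at_least0 ?at_least_gt0 //.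
by rewrite at_leastS; apply: measurableU => //; exact: measurableI.
Qed.

(** * Votes of disjoint blocks *)

Section blocks.
Context {R : realType} {d d' : measure_display}.
Context {T : measurableType d} {S : measurableType d'}.

(** The default value of [nth] is reached only if the block overflows the
    sample. *)
Definition block (b i n : nat) (x : n.-tuple S) : b.-tuple S :=
  [tuple nth point x (i * b + l)%N | l < b].

Lemma measurable_block (b i n : nat) :
  measurable_fun setT (@block b i n).
Proof.
apply/measurable_fun_tnthP => l.
have [iln|nil] := ltnP (i * b + l)%N n; last first.
  rewrite (_ : _ \o _ = cst point); first exact: measurable_cst.
  apply/funext => x; rewrite /= tnth_mktuple nth_default //.
  by rewrite size_tuple.
rewrite (_ : _ \o _ = (@tnth n S)^~ (Ordinal iln)).
  exact: measurable_tnth.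
by apply/funext => x; rewrite /= tnth_mktuple (tnth_nth point).
Qed.

Lemma block_sample (X : nat -> {mfun T >-> S}) (b i n : nat) (w : T) :
  (i.+1 * b <= n)%N ->
  block b i (sample X n w) = sample (shifted X (i * b)) b w.
Proof.
move=> ibn; apply: eq_from_tnth => l; rewrite !tnth_mktuple.
have iln : (i * b + l < n)%N.
  by rewrite (leq_trans _ ibn) // mulSn addnC ltn_add2r.
by rewrite (nth_map (Ordinal iln)) ?size_enum_ord // nth_enum_ord.
Qed.

Definition votes (X : nat -> {mfun T >-> S}) (b : nat) (C : set (b.-tuple S))
    (i : nat) : set T :=
  sample (shifted X (i * b)) b @^-1` C.

Lemma sample_at_least (X : nat -> {mfun T >-> S}) (b j k n : nat)
    (C : set (b.-tuple S)) : (j * b <= n)%N ->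
  sample X n @^-1` at_least (fun i => @block b i n @^-1` C) j k =
  at_least (votes X C) j k.
Proof.
move=> jbn; rewrite preimage_at_least; apply: eq_at_least => i ij.
apply/funext => w; rewrite /votes /preimage /= block_sample //.
by rewrite (leq_trans _ jbn) // leq_mul2r ij orbT.
Qed.

Lemma measurable_votes (X : nat -> {mfun T >-> S}) (b i : nat)
    (C : set (b.-tuple S)) : measurable C -> measurable (votes X C i).
Proof.
by move=> mC; rewrite -[X in measurable X]setTI; exact: measurable_sample.
Qed.

(** The first [j] votes are a function of the first [j * b] observations, from
    which the block number [j] is disjoint. *)
Lemma votes_indep (mu : probability T R) (X : nat -> {mfun T >-> S})
    (P : probability S R) (b j k : nat) (C : set (b.-tuple S)) :
    iid_with_law mu X P -> measurable C ->
  mu (at_least (votes X C) j k `&` votes X C j) =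
    (mu (at_least (votes X C) j k) * mu (votes X C j))%E.
Proof.
move=> iidX mC; rewrite -(sample_at_least X k C (leqnn _)).
apply: (sample_shifted_indep iidX) => //.
apply: measurable_at_least => i; rewrite -[X in measurable X]setTI.
exact: measurable_block.
Qed.

(** A weak form of the binomial tail bound: [2 ^ j] replaces the number of ways
    to choose the [k] blocks, which makes the induction immediate. *)
Lemma probability_at_least_votes (mu : probability T R)
    (X : nat -> {mfun T >-> S}) (P : probability S R) (b j k : nat)
    (C : set (b.-tuple S)) (p : R) :
    iid_with_law mu X P -> measurable C -> 0 <= p ->
    (mu (sample X b @^-1` C) <= p%:E)%E ->
  (mu (at_least (votes X C) j k) <= (2 ^+ j * p ^+ k)%:E)%E.
Proof.
move=> iidX mC p0 Cp.
have mV i := measurable_votes X i mC.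
have mL a c : measurable (at_least (votes X C) a c).
  exact: measurable_at_least.
elim: j k => [|j IH] [|k].
- by rewrite expr0 mul1r probability_le1.
- by rewrite at_least_gt0 measure0 lee_fin mul1r exprn_ge0.
- rewrite expr0 mulr1 (le_trans (probability_le1 _ _)) // lee_fin.
  by rewrite exprn_ege1 // ler1n.
- have -> : 2 ^+ j.+1 * p ^+ k.+1 = 2 ^+ j * p ^+ k.+1 + 2 ^+ j * p ^+ k * p.
    by rewrite exprS [p ^+ k.+1]exprSr; ring.
  have leU : (mu (at_least (votes X C) j k.+1 `|`
        (at_least (votes X C) j k `&` votes X C j)) <=
      mu (at_least (votes X C) j k.+1) +
        mu (at_least (votes X C) j k `&` votes X C j))%E.
    by apply: measureU2 => //; exact: measurableI.
  rewrite at_leastS (le_trans leU) //.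
  rewrite EFinD leeD //.
  rewrite EFinM (votes_indep _ _ iidX mC) lee_pmul //.
  by rewrite (le_trans _ Cp) // le_eqVlt (sample_shifted_law iidX) ?eqxx.
Qed.

End blocks.

(** * Events that occur finitely often *)

Section finitely_often.
Context {R : realType} {d : measure_display} {T : measurableType d}.

Lemma lim_sup_setC (F : nat -> set T) :
  ~` lim_sup_set F = [set w | finite_set [set n | F n w]].
Proof.
apply/seteqP; split => w.
  move=> /existsNP[m /not_implyP[_ Fm]].
  apply: (@sub_finite_set _ _ `I_m) => [n /= Fn|]; last exact: finite_II.
  by rewrite ltnNge; apply/negP => mn; apply: Fm; exists n.
move=> finF limF.
pose m := (\max_(i <- fset_set [set n | F n w]) i).+1.
have [n /= mn Fn] := limF m I.
have : n \in fset_set [set n | F n w] by rewrite in_fset_set // inE.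
move=> /(@leq_bigmax_seq _ _ xpredT id) /(_ isT).
by rewrite leqNgt mn.
Qed.

(** Borel-Cantelli along a reindexing: the probabilities of the events [E (h n)]
    need not be summable in [n], because many [n] may share the same [h n]. *)
Lemma finitely_often_prob1 (mu : probability T R) (E F : nat -> set T)
    (h : nat -> nat) :
    (forall k, measurable (E k)) -> (forall n, measurable (F n)) ->
    (\sum_(k <oo) mu (E k) < +oo)%E ->
    (forall m, \forall n \near \oo, (m <= h n)%N) ->
    (forall n, F n `<=` E (h n)) ->
  mu [set w | finite_set [set n | F n w]] = 1%E.
Proof.
move=> mE mF sumE hoo FE.
have mlim (G : nat -> set T) : (forall k, measurable (G k)) ->
    measurable (lim_sup_set G).
  move=> mG; apply: bigcap_measurable => // k _.
  exact: bigcup_measurable.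
have limFE : lim_sup_set F `<=` lim_sup_set E.
  move=> w limF m _; have [N _ hN] := hoo m.
  have [n /= Nn /FE Ehn] := limF N I.
  by exists (h n) => //=; exact: hN.
rewrite -lim_sup_setC probability_setC; last exact: mlim.
have -> : mu (lim_sup_set F) = 0%E; last by rewrite sube0.
apply: (subset_measure0 _ _ limFE); [exact: mlim|exact: mlim|].
exact: lim_sup_set_cvg0.
Qed.

Lemma half_markov (mu : probability T R) (f : T -> R) :
    measurable_fun setT f -> (forall w, 0 <= f w) ->
  (mu [set w | (2^-1 <= f w)%R] <= 2%:E * 'E_mu[f])%E.
Proof.
move=> mf f0.
pose X : {RV mu >-> R} := HB.pack f (isMeasurableFun.Build _ _ _ _ f mf).
have := @markov _ _ _ mu X id 2^-1.
rewrite invr_gt0 ltr0n => /(_ isT (@measurable_id _ _ _) (fun _ => id)).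
have -> : [set w | ((2^-1)%:E <= `|(X w)%:E|)%E] = [set w | 2^-1 <= f w].
  by apply/seteqP; split => w /=; rewrite lee_fin ger0_norm.
have -> : (id \o Num.norm) \o X = f.
  by apply/funext => w /=; rewrite ger0_norm.
move=> /(_ _) mk.
rewrite -lee_pdivrMl ?ltr0n //; apply: mk.
by move=> x y _ _.
Qed.

Lemma near_half_markov (mu : probability T R) (f : nat -> T -> R) :
    (forall n, measurable_fun setT (f n)) -> (forall n w, 0 <= f n w) ->
    ('E_mu[f n])%E @[n --> \oo] --> 0%E ->
  \forall n \near \oo, (mu [set w | (2^-1 <= f n w)%R] <= (8^-1)%:E)%E.
Proof.
move=> mf f0 /fine_cvgP[fin_f /cvgr0_norm_lt f_0].
have := f_0 16^-1; rewrite invr_gt0 ltr0n => /(_ isT) f_16.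
near=> n.
rewrite (le_trans (half_markov mu (mf n) (f0 n))) //.
have fn : 'E_mu[f n]%E \is a fin_num by near: n.
rewrite -(fineK fn) -EFinM lee_fin.
have : `|fine 'E_mu[f n]%E| < 16^-1 by near: n.
move=> /(le_lt_trans (ler_norm _)); lra.
Unshelve. all: by end_near.
Qed.

End finitely_often.

(** * The majority vote *)

Section majority.
Context {R : realType} {d d' : measure_display}.
Context {T : measurableType d} {S : measurableType d'}.

(** Any sequence [k] tending to infinity with [2 k^2 <= n] would do; with base 4
    both properties follow from [k < 2 ^ k] and [2 k <= 2 ^ k]. *)
Definition block_size (n : nat) : nat := trunc_log 4 n.

Lemma block_size_cvg (m : nat) : \forall n \near \oo, (m <= block_size n)%N.
Proof. by exists (4 ^ m)%N => // n /=; exact: trunc_log_max. Qed.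

Lemma blocks_fit (n : nat) : ((block_size n).*2 * block_size n <= n)%N.
Proof.
case: n => [|n]; first by rewrite /block_size trunc_log0.
have := @trunc_logP 4 n.+1 isT isT; rewrite -/(block_size n.+1).
apply: leq_trans; set k := block_size _.
rewrite (_ : 4 = 2 * 2)%N // expnMn leq_mul //; last exact/ltnW/ltn_expl.
by case: k => // k; rewrite -mul2n expnS leq_mul2l /= ltn_expl.
Qed.

(** [C b] is the event that a block of length [b] votes wrongly, and [F n] the
    event that the majority vote based on [n] observations errs. *)
Lemma majority_finitely_often (mu : probability T R)
    (X : nat -> {mfun T >-> S}) (P : probability S R)
    (C : forall b, set (b.-tuple S)) (F : nat -> set T) :
    iid_with_law mu X P ->
    (forall b, measurable (C b)) -> (forall n, measurable (F n)) ->
    (forall n, F n `<=`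
      at_least (votes X (C (block_size n))) (block_size n).*2 (block_size n)) ->
    (\forall b \near \oo, (mu (sample X b @^-1` C b) <= (8^-1)%:E)%E) ->
  mu [set w | finite_set [set n | F n w]] = 1%E.
Proof.
move=> iidX mC mF FC [N _ C8].
pose E b := at_least (votes X (C b)) b.*2 b.
have mE b : measurable (E b).
  by apply: measurable_at_least => i; exact: measurable_votes.
apply: (@finitely_often_prob1 _ _ _ mu E F block_size) => //; last first.
  exact: block_size_cvg.
(* From [N] on, the bound [2 ^ (2b) / 8 ^ b = 2 ^ - b] applies; the factor
   [2 ^ N] covers the finitely many smaller [b], and the remaining power of 2
   matches the general term of the geometric series used below. *)
have muE b : (mu (E b) <= (2 ^+ N.+1 / (2 ^ (b + 1))%:R)%:E)%E.
  have [Nb|bN] := leqP N b.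
    have := probability_at_least_votes b.*2 b iidX (mC b) _ (C8 b Nb).
    rewrite invr_ge0 ler0n => /(_ isT) /le_trans; apply.
    rewrite lee_fin -mul2n exprM -exprMn.
    rewrite (_ : 2 ^+ 2 * 8^-1 = 2^-1); last by lra.
    rewrite exprVn natrX addn1 [2 ^+ N.+1]exprS.
    rewrite [2 ^+ b.+1]exprS invfM mulrACA divff ?mul1r ?pnatr_eq0 //.
    by rewrite ler_peMl ?exprn_ege1 ?ler1n ?invr_ge0 ?exprn_ge0.
  rewrite (le_trans (probability_le1 _ _)) // lee_fin natrX.
  rewrite ler_pdivlMr ?exprn_gt0 // mul1r ler_weXn2l ?ler1n // addn1 ltnS.
  exact: ltnW.
apply: (@le_lt_trans _ _ (2 ^+ N.+1 / 2 ^+ 0)%:E); last by rewrite ltry.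
have /cvg_lim <- // := @cvg_geometric_eseries_half R (2 ^+ N.+1) 0.
exact: lee_nneseries.
Qed.

End majority.

Theorem theorem3p3 (R : realType) (Omega : ptopologicalType)
    (d : measure_display) (T : measurableType d)
    (X : nat -> {mfun T >-> borelType Omega})
    (Pr : probability (borelType Omega) R -> probability T R)
    (iidX : forall P : probability (borelType Omega) R,
      iid_with_law (Pr P) X P)
    (Theta0 Theta1 : set (probability (borelType Omega) R)) :
  (exists K : forall n : nat, n.-tuple (borelType Omega) -> R,
    (forall n, is_test (K n)) /\
    pointwise_consistent X Pr Theta0 Theta1 K) ->
  exists K : forall n : nat, n.-tuple (borelType Omega) -> R,
    (forall n, is_nonrandomized_test (K n)) /\
    discernible X Pr Theta0 Theta1 K.
Proof.
move=> [K [testK [consK0 consK1]]].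
pose C b : set (b.-tuple (borelType Omega)) := [set x | 2^-1 <= K b x].
have mC b : measurable (C b).
  have [mK _] := testK b.
  have -> : C b = K b @^-1` `[2^-1, +oo[%classic.
    by apply/seteqP; split => x; rewrite /C /= in_itv /= andbT.
  by rewrite -[X in measurable X]setTI; exact: mK.
pose D n := at_least (fun i => @block _ _ (block_size n) i n @^-1`
  C (block_size n)) (block_size n).*2 (block_size n).
have mD n : measurable (D n).
  apply: measurable_at_least => i; rewrite -[X in measurable X]setTI.
  by apply: measurable_block => //; exact: mC.
have sampleD n : sample X n @^-1` D n = at_least (votes X (C (block_size n)))
    (block_size n).*2 (block_size n).
  exact/sample_at_least/blocks_fit.
have mDX n : measurable (sample X n @^-1` D n).
  rewrite -[X in measurable X]setTI; apply: measurable_sample => //.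
  exact: mD.
have mKX n : measurable_fun setT (fun w => K n (sample X n w)).
  by apply: measurableT_comp; [have [] := testK n|exact: measurable_sample].
have rejectE n : [set w | \1_(D n) (sample X n w) = 1 :> R] =
    sample X n @^-1` D n.
  apply/seteqP; split => w /=; rewrite indicE; last by move=> /mem_set ->.
  by case: (boolP (_ \in _)) => [/set_mem//|_ /esym/eqP]; rewrite oner_eq0.
have acceptE n : [set w | \1_(D n) (sample X n w) = 0 :> R] =
    ~` (sample X n @^-1` D n).
  apply/seteqP; split => w /=; rewrite indicE; last first.
    by move=> nD; rewrite (_ : _ \in _ = false) //; exact: memNset.
  case: (boolP (_ \in _)) => [_ /eqP|/negP nD _ /mem_set//].
  by rewrite oner_eq0.
exists (fun n => \1_(D n)); split.
  move=> n; split=> [|x].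
    split=> [|x]; first by apply: measurable_indic; exact: mD.
    by rewrite indicE; case: (_ \in _); rewrite /= ?ler01 ?lexx.
  by rewrite indicE; case: (_ \in _); [right|left].
split => P ThetaP.
- apply: (majority_finitely_often (iidX P) mC
      (F := fun n => [set w | \1_(D n) (sample X n w) = 1])).
  + by move=> n; rewrite rejectE.
  + by move=> n; rewrite rejectE sampleD.
  apply: (near_half_markov (f := fun n w => K n (sample X n w))) => //.
    by move=> n w; have [_ /(_ (sample X n w)) /andP[]] := testK n.
  exact: consK0.
(* Under the alternative, the votes that are wrong are those for acceptance. *)
- have mCc b : measurable (~` C b) by apply: measurableC; exact: mC.
  apply: (majority_finitely_often (iidX P) mCc
      (F := fun n => [set w | \1_(D n) (sample X n w) = 0])).
  + by move=> n; rewrite acceptE; apply: measurableC; exact: mDX.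
  + move=> n; rewrite acceptE sampleD.
    by apply: at_leastC; rewrite addnn.
  have m1K n : measurable_fun setT (fun w => 1 - K n (sample X n w)).
    exact: measurable_funB.
  have := near_half_markov (f := fun n w => 1 - K n (sample X n w)) m1K _
    (consK1 _ ThetaP).
  have K1 n w : 0 <= 1 - K n (sample X n w).
    by have [_ /(_ (sample X n w)) /andP[_]] := testK n; rewrite subr_ge0.
  move=> /(_ K1); apply: filterS => n; apply: le_trans.
  apply: le_measure; rewrite ?inE.
  + rewrite -[X in measurable X]setTI; apply: measurable_sample => //.
    exact: mCc.
  + rewrite (_ : [set _ | _] =
      (fun w => 1 - K n (sample X n w)) @^-1` `[2^-1, +oo[%classic).
      by rewrite -[X in measurable X]setTI; exact: m1K.
    by apply/seteqP; split => x; rewrite /= in_itv /= andbT.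
  + by move=> w /negP; rewrite /C /= -ltNge => Kw; lra.
Qed.
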